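(* Let $k$ be a field, $\mathfrak S$ a $k$-linear Grothendieck category, $H$ a cosemisimple Hopf algebra over $k$, $A$ a right $H$-comodule algebra and $B=A^{coH}$. Then there are natural isomorphisms $${}_A\mathfrak S^H(A\otimes_B\mathcal M,\mathcal N)\cong{}_B\mathfrak S(\mathcal M,\mathfrak C^H(\mathcal N))$$ for $\mathcal M\in{}_B\mathfrak S$ and $\mathcal N\in{}_A\mathfrak S^H$.
   Context: Write $\otimes=\otimes_k$. For $\mathcal M\in\mathfrak S$ and a $k$-vector space $V$, $\mathcal M\otimes V\in\mathfrak S$ is defined by letting $\mathcal M\otimes-:k\text{-Mod}\to\mathfrak S$ be the left adjoint of $\mathfrak S(\mathcal M,-)$; we identify $V\otimes\mathcal M$ with $\mathcal M\otimes V$, and $T$ denotes such swap isomorphisms. For a $k$-algebra $R$, ${}_R\mathfrak S$ is the category of left $R$-module objects in $\mathfrak S$ (objects with an associative unital action $R\otimes\mathcal M\to\mathcal M$). $H$ is cosemisimple if there is a left integral $\phi:H\to k$ (i.e. a $k$-linear map with $\sum h_1\phi(h_2)=\phi(h)1_H$ for all $h$) such that $\phi(1_H)=1$. ${}_A\mathfrak S^H$ is the category of left-right relative $(A,H)$-Hopf module objects in $\mathfrak S$: triples $(\mathcal M,\mu_{\mathcal M}^A,\Delta_{\mathcal M}^H)$ where $\mu_{\mathcal M}^A:A\otimes\mathcal M\to\mathcal M$ is a left $A$-module structure on $\mathcal M\in\mathfrak S$, $\Delta_{\mathcal M}^H:\mathcal M\to\mathcal M\otimes H$ is a right $H$-comodule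 structure, and $\Delta^H_{\mathcal M}\circ\mu^A_{\mathcal M}=(\mu^A_{\mathcal M}\otimes\mu_H)\circ(A\otimes T_{H,\mathcal M}\otimes H)\circ(\Delta_A^H\otimes\Delta^H_{\mathcal M})$; morphisms are morphisms in $\mathfrak S$ compatible with the $A$-action and $H$-coaction. $B=\{a\in A\mid\Delta_A^H(a)=a\otimes1_H\}$. For $\mathcal N\in{}_A\mathfrak S^H$, $\mathfrak C^H(\mathcal N)$ is the equalizer in $\mathfrak S$ of $\mathcal N\otimes u_H,\ \Delta^H_{\mathcal N}:\mathcal N\rightrightarrows\mathcal N\otimes H$ ($u_H$ the unit of $H$); the $A$-action on $\mathcal N$ restricts to a left $B$-module structure on $\mathfrak C^H(\mathcal N)$. For $\mathcal M\in{}_B\mathfrak S$, $A\otimes_B\mathcal M$ is the coequalizer in $\mathfrak S$ of the two action morphisms $A\otimes B\otimes\mathcal M\rightrightarrows A\otimes\mathcal M$; it lies in ${}_A\mathfrak S^H$ with $A$ acting by left multiplication and $H$-coaction induced by $\Delta_A^H$. *)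

(* Defs.v *)
From HB Require Import structures.
From mathcomp Require Import all_boot all_order all_algebra.
From mathcomp Require Import sesquilinear generic_quotient.
From mathcomp Require Import boolp.

Set Implicit Arguments.
Unset Strict Implicit.
Unset Printing Implicit Defensive.

Import GRing.Theory.
Local Open Scope ring_scope.
Local Open Scope quotient_scope.

Definition Lin (k : fieldType) (U V : lmodType k) (f : U -> V)
    (hf : linear f) : {linear U -> V} :=
  HB.pack f (GRing.isLinear.Build k U V *:%R f hf).

Definition Bil (k : fieldType) (U V W : lmodType k) (f : U -> V -> W)
    (hl : forall v, linear (f^~ v)) (hr : forall u, linear (f u)) :
    {bilinear U -> V -> W} :=
  HB.pack f (bilinear_isBilinear.Build k U V W *:%R *:%R f (hl, hr)).

Lemma LinE (k : fieldType) (U V : lmodType k) (f : U -> V) (hf : linear f) x :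
  Lin hf x = f x.
Proof. by []. Qed.

Lemma BilE (k : fieldType) (U V W : lmodType k) (f : U -> V -> W) hl hr x y :
  @Bil k U V W f hl hr x y = f x y.
Proof. by []. Qed.

Arguments Lin : simpl never.
Arguments Bil : simpl never.

Section VTens.
Variables (k : fieldType) (V W : lmodType k).

(* An element of V ⊗ W is represented by a finite list of pairs, read as the
   sum of the pure tensors; two lists are identified when no bilinear map
   separates them. The universal property is vlift_pure and vtens_ext. *)
Definition bsum (U : lmodType k) (f : {bilinear V -> W -> U})
    (s : seq (V * W)) : U := \sum_(x <- s) f x.1 x.2.

Definition vtens_rel (s t : seq (V * W)) : bool :=
  `[< forall (U : lmodType k) (f : {bilinear V -> W -> U}),
        bsum f s = bsum f t >].

Lemma vtens_rel_equiv : equiv_class_of vtens_rel.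
Proof.
split=> [s|s t|t s u].
- by apply/asboolP.
- by apply/asboolP/asboolP=> h U f; rewrite h.
- move=> /asboolP h1 /asboolP h2; apply/asboolP=> U f.
  by rewrite h1 h2.
Qed.
Canonical vtens_equiv := EquivRelPack vtens_rel_equiv.

Definition vtens : Type := {eq_quot vtens_rel}.
HB.instance Definition _ := Choice.on vtens.
HB.instance Definition _ := EqQuotient.on vtens.

Lemma vtens_eqP s t :
  reflect (forall (U : lmodType k) (f : {bilinear V -> W -> U}),
     bsum f s = bsum f t) (\pi_vtens s == \pi_vtens t).
Proof. by rewrite piE; apply: asboolP. Qed.

Lemma vtens_repr (U : lmodType k) (f : {bilinear V -> W -> U}) s :
  bsum f (repr (\pi_vtens s)) = bsum f s.
Proof. by apply/vtens_eqP; rewrite reprK. Qed.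

Let add (x y : vtens) : vtens := \pi_vtens (repr x ++ repr y).
Let scale (a : k) (x : vtens) : vtens :=
  \pi_vtens [seq (a *: z.1, z.2) | z <- repr x].
Let zero : vtens := \pi_vtens [::].

Let bsum_cat (U : lmodType k) (f : {bilinear V -> W -> U}) s t :
  bsum f (s ++ t) = bsum f s + bsum f t.
Proof. by rewrite /bsum big_cat. Qed.

Let bsum_scale (U : lmodType k) (f : {bilinear V -> W -> U}) a s :
  bsum f [seq (a *: z.1, z.2) | z <- s] = a *: bsum f s.
Proof.
rewrite /bsum big_map scaler_sumr; apply: eq_bigr => i _ /=.
by rewrite linearZl_LR.
Qed.

Let bsum_nil (U : lmodType k) (f : {bilinear V -> W -> U}) : bsum f [::] = 0.
Proof. by rewrite /bsum big_nil. Qed.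

Let vbE := (vtens_repr, bsum_cat, bsum_scale, bsum_nil).

Let vtensP (x y : vtens) : (forall (U : lmodType k) (f : {bilinear V -> W -> U}),
  bsum f (repr x) = bsum f (repr y)) -> x = y.
Proof. by move=> h; rewrite -[x]reprK -[y]reprK; apply/eqP/vtens_eqP. Qed.

Let vaddA : associative add.
Proof. by move=> x y z; apply: vtensP => U f; rewrite !vbE addrA. Qed.
Let vaddC : commutative add.
Proof. by move=> x y; apply: vtensP => U f; rewrite !vbE addrC. Qed.
Let vadd0 : left_id zero add.
Proof. by move=> x; apply: vtensP => U f; rewrite !vbE add0r. Qed.
Let vaddN : left_inverse zero (scale (-1)) add.
Proof. by move=> x; apply: vtensP => U f; rewrite !vbE scaleN1r addNr. Qed.
HB.instance Definition _ :=
  GRing.isZmodule.Build vtens vaddA vaddC vadd0 vaddN.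

Let vscaleA a b x : scale a (scale b x) = scale (a * b) x.
Proof. by apply: vtensP => U f; rewrite !vbE scalerA. Qed.
Let vscale1 : left_id 1 scale.
Proof. by move=> x; apply: vtensP => U f; rewrite !vbE scale1r. Qed.
Let vscaleDr : right_distributive scale +%R.
Proof. by move=> a x y; apply: vtensP => U f; rewrite !vbE scalerDr. Qed.
Let vscaleDl x : {morph scale^~ x : a b / a + b}.
Proof. by move=> a b; apply: vtensP => U f; rewrite !vbE scalerDl. Qed.
HB.instance Definition _ :=
  GRing.Zmodule_isLmodule.Build k vtens vscaleA vscale1 vscaleDr vscaleDl.

Definition tens_space : lmodType k := vtens.

Definition vpure (v : V) (w : W) : tens_space := \pi_vtens [:: (v, w)].

Let bsum1 (U : lmodType k) (f : {bilinear V -> W -> U}) v w : bsum f [:: (v, w)] = f v w.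
Proof. by rewrite /bsum big_seq1. Qed.

Let vaddE (x y : vtens) : x + y = add x y. Proof. by []. Qed.
Let vscaleE a (x : vtens) : a *: x = scale a x. Proof. by []. Qed.

Lemma vpure_linl w : linear (vpure^~ w).
Proof.
move=> a u v; apply: vtensP => U f.
by rewrite vaddE vscaleE /vpure !vbE !bsum1 linearPl.
Qed.
Lemma vpure_linr v : linear (vpure v).
Proof.
move=> a u w; apply: vtensP => U f.
by rewrite vaddE vscaleE /vpure !vbE !bsum1 linearPr.
Qed.

Fact vtens_key : unit. Proof. by []. Qed.

Section Lift.
Variables (U : lmodType k) (f : {bilinear V -> W -> U}).
Let g (x : tens_space) : U := bsum f (repr (x : vtens)).
Let vlift_linear : linear g.
Proof. by move=> a x y; rewrite /g vaddE vscaleE !vbE. Qed.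
Definition vlift : {linear tens_space -> U} :=
  locked_with vtens_key (Lin vlift_linear).
Lemma vlift_pure v w : vlift (vpure v w) = f v w.
Proof. by rewrite /vlift unlock LinE /g !vbE bsum1. Qed.
End Lift.

Lemma vtens_sum (x : tens_space) : x = \sum_(z <- repr (x : vtens)) vpure z.1 z.2.
Proof.
rewrite -[LHS](@reprK _ vtens); elim: (repr _) => [|z s IHs]; first by rewrite big_nil.
rewrite big_cons -IHs; case: z => v w /=.
by apply: vtensP => U f; rewrite vaddE !vbE !bsum1 /bsum big_cons.
Qed.

Lemma vtens_ext (U : lmodType k) (f g : {linear tens_space -> U}) :
  (forall v w, f (vpure v w) = g (vpure v w)) -> f =1 g.
Proof.
move=> h x; rewrite [x]vtens_sum !linear_sum.
by apply: eq_bigr => z _; rewrite h.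
Qed.
End VTens.

Notation "V ⊗ W" := (tens_space V W) (at level 40, left associativity).
Notation "v ⊗t w" := (vpure v w) (at level 40, left associativity).

Section VTensMap.
Variable k : fieldType.
Implicit Types U V W : lmodType k.

Lemma lin_comb U V (c : k) (f g : U -> V) : linear f -> linear g ->
  linear (fun x => c *: f x + g x).
Proof.
move=> hf hg b y z; rewrite hf hg !scalerDr !scalerA (mulrC c).
by rewrite -!addrA; congr (_ + _); rewrite addrCA.
Qed.

Lemma lin_compose U V W (f : V -> W) (g : U -> V) :
  linear f -> linear g -> linear (f \o g).
Proof. by move=> hf hg c x y /=; rewrite hg hf. Qed.

Lemma lin_id V : linear (@idfun V). Proof. by []. Qed.
Definition lid V : {linear V -> V} := Lin (@lin_id V).

Section Map.
Variables (V V' W W' : lmodType k) (f : {linear V -> V'}) (g : {linear W -> W'}).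
Let F (v : V) (w : W) : V' ⊗ W' := f v ⊗t g w.
Let Fl w : linear (F^~ w).
Proof. by move=> a u v; rewrite /F linearP vpure_linl. Qed.
Let Fr v : linear (F v).
Proof. by move=> a u w; rewrite /F linearP vpure_linr. Qed.
Definition vmap : {linear V ⊗ W -> V' ⊗ W'} := vlift (Bil Fl Fr).
Lemma vmap_pure v w : vmap (v ⊗t w) = f v ⊗t g w.
Proof. by rewrite /vmap vlift_pure BilE. Qed.
End Map.

Section Assoc.
Variables U V W : lmodType k.
Let F (w : W) (u : U) (v : V) : U ⊗ (V ⊗ W) := u ⊗t (v ⊗t w).
Let Fl w v : linear ((F w)^~ v).
Proof. by move=> a u u'; rewrite /F vpure_linl. Qed.
Let Fr w u : linear (F w u).
Proof. by move=> a v v'; rewrite /F vpure_linl vpure_linr. Qed.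
Let Fc a w w' u v : F (a *: w + w') u v = a *: F w u v + F w' u v.
Proof. by rewrite /F !vpure_linr. Qed.
Let G (x : U ⊗ V) (w : W) : U ⊗ (V ⊗ W) := vlift (Bil (Fl w) (Fr w)) x.
Let Gl w : linear (G^~ w).
Proof. by move=> a x y; rewrite /G linearP. Qed.
Let Gr x : linear (G x).
Proof.
move=> a w w'.
have h : linear (fun y => a *: G y w + G y w') by apply: lin_comb; apply: Gl.
rewrite -[RHS]/(Lin h x) /G; apply: vtens_ext => u v.
by rewrite LinE /G !vlift_pure !BilE Fc.
Qed.
Definition vassoc : {linear (U ⊗ V) ⊗ W -> U ⊗ (V ⊗ W)} := vlift (Bil Gl Gr).
Lemma vassoc_pure u v w : vassoc ((u ⊗t v) ⊗t w) = u ⊗t (v ⊗t w).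
Proof. by rewrite /vassoc vlift_pure BilE /G vlift_pure BilE. Qed.
End Assoc.
End VTensMap.

(* Unital associative k-algebras. Unlike in algType, the zero algebra is
   allowed; algebra_of embeds algType. *)
Record algebra (k : fieldType) := MkAlgebra {
  alg_space :> lmodType k;
  alg_one : alg_space;
  alg_mul : {bilinear alg_space -> alg_space -> alg_space};
  alg_mulA : forall x y z, alg_mul x (alg_mul y z) = alg_mul (alg_mul x y) z;
  alg_mul1l : forall x, alg_mul alg_one x = x;
  alg_mul1r : forall x, alg_mul x alg_one = x
}.
Arguments alg_one {k a}.
Arguments alg_mul {k a}.
Notation "x ∙ y" := (alg_mul x y) (at level 40, left associativity).

Section AlgebraOf.
Variables (k : fieldType) (A : algType k).
Let ml (y : A) : linear (fun x => x * y).
Proof. by move=> a u v; rewrite mulrDl scalerAl. Qed.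
Let mr (x : A) : linear (fun y => x * y).
Proof. by move=> a u v; rewrite mulrDr scalerAr. Qed.
Definition algebra_of : algebra k :=
  @MkAlgebra k A 1 (Bil ml mr) (@mulrA A) (@mul1r A) (@mulr1 A).
End AlgebraOf.

Definition alg_morph (k : fieldType) (A B : algebra k) (f : {linear A -> B}) :=
  f alg_one = alg_one /\ forall x y, f (x ∙ y) = f x ∙ f y.

Section Mult.
Variables (k : fieldType) (R : algebra k).
Definition amul : {linear R ⊗ R -> R} := vlift alg_mul.
Lemma amul_pure x y : amul (x ⊗t y) = x ∙ y.
Proof. exact: vlift_pure. Qed.

Lemma aunit_linear : linear (fun c : k^o => (c : k) *: (alg_one : R)).
Proof. by move=> a u v; rewrite scalerDl scalerA. Qed.
Definition aunit : {linear k^o -> R} := Lin aunit_linear.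
End Mult.
Arguments amul {k} R.
Arguments aunit {k} R.

Section TensAlg.
Variables (k : fieldType) (A B : algebra k).

Let lmul (a : A) : {linear A -> A} := alg_mul a.
Let lmulB (b : B) : {linear B -> B} := alg_mul b.
Let F (y : A ⊗ B) (a : A) (b : B) : A ⊗ B := vmap (lmul a) (lmulB b) y.

Let Fext (G G' : A ⊗ B -> A ⊗ B) : linear G -> linear G' ->
  (forall a b, G (a ⊗t b) = G' (a ⊗t b)) -> G =1 G'.
Proof. by move=> h h' e x; exact: (@vtens_ext _ _ _ _ (Lin h) (Lin h')). Qed.

Let Flin a b : linear (fun y => F y a b).
Proof. by move=> c y z; rewrite /F linearP. Qed.
Let Fl y b : linear ((F y)^~ b).
Proof.
move=> c a a'.
apply: (Fext (G := fun y => F y (c *: a + a') b)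
             (G' := fun y => c *: F y a b + F y a' b)) => //.
  by apply: lin_comb.
by move=> x z; rewrite /F !vmap_pure /lmul /lmulB /= linearPl vpure_linl.
Qed.
Let Fr y a : linear (F y a).
Proof.
move=> c b b'.
apply: (Fext (G := fun y => F y a (c *: b + b'))
             (G' := fun y => c *: F y a b + F y a b')) => //.
  by apply: lin_comb.
by move=> x z; rewrite /F !vmap_pure /lmul /lmulB /= linearPl vpure_linr.
Qed.

(* (a ⊗ b) (a' ⊗ b') = (a a') ⊗ (b b'), see tmul_pure. *)
Definition tmul (x y : A ⊗ B) : A ⊗ B := vlift (Bil (Fl y) (Fr y)) x.
Lemma tmul_pure a b a' b' :
  tmul (a ⊗t b) (a' ⊗t b') = (a ∙ a') ⊗t (b ∙ b').
Proof. by rewrite /tmul vlift_pure BilE /F vmap_pure. Qed.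

Lemma tmul_linl y : linear (tmul^~ y).
Proof. by move=> c x x'; rewrite /tmul linearP. Qed.
Lemma tmul_linr x : linear (tmul x).
Proof.
move=> c y y'.
apply: (Fext (G := fun x => tmul x (c *: y + y'))
             (G' := fun x => c *: tmul x y + tmul x y')) => [||a b].
- exact: tmul_linl.
- by apply: lin_comb; apply: tmul_linl.
by rewrite /tmul !vlift_pure !BilE Flin.
Qed.

Lemma tmulA : associative tmul.
Proof.
move=> x y z.
apply: (Fext (G := fun x => tmul x (tmul y z))
             (G' := fun x => tmul (tmul x y) z)) => [||a b].
- exact: tmul_linl.
- exact: (lin_compose (tmul_linl _) (tmul_linl _)).
apply: (Fext (G := fun y => tmul (a ⊗t b) (tmul y z))
             (G' := fun y => tmul (tmul (a ⊗t b) y) z)) => [||a' b'].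
- exact: (lin_compose (tmul_linr _) (tmul_linl _)).
- exact: (lin_compose (tmul_linl _) (tmul_linr _)).
apply: (Fext (G := fun z => tmul (a ⊗t b) (tmul (a' ⊗t b') z))
             (G' := fun z => tmul (tmul (a ⊗t b) (a' ⊗t b')) z)) => [||a'' b''].
- exact: (lin_compose (tmul_linr _) (tmul_linr _)).
- exact: tmul_linr.
by rewrite !tmul_pure !alg_mulA.
Qed.
Lemma tmul1l : left_id (alg_one ⊗t alg_one) tmul.
Proof.
apply: Fext; [exact: tmul_linr|by []|].
by move=> a b; rewrite tmul_pure !alg_mul1l.
Qed.
Lemma tmul1r : right_id (alg_one ⊗t alg_one) tmul.
Proof.
apply: Fext; [exact: tmul_linl|by []|].
by move=> a b; rewrite tmul_pure !alg_mul1r.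
Qed.

Definition tens_algebra : algebra k :=
  @MkAlgebra k (A ⊗ B) (alg_one ⊗t alg_one) (Bil tmul_linl tmul_linr)
    tmulA tmul1l tmul1r.
End TensAlg.

Section LinMaps.
Variable k : fieldType.

Lemma rscale_linl (V : lmodType k) (C : lmodType k) (f : {linear C -> k^o})
  (y : C) : linear (fun x : V => (f y : k) *: x).
Proof. by move=> a u v; rewrite scalerDr !scalerA mulrC. Qed.
Lemma rscale_linr (V : lmodType k) (C : lmodType k) (f : {linear C -> k^o})
  (x : V) : linear (fun y : C => (f y : k) *: x).
Proof. by move=> a u v; rewrite linearP scalerDl scalerA. Qed.

(* rscale f (x ⊗ y) = f y x and lscale f (y ⊗ x) = f y x *)
Definition rscale (V C : lmodType k) (f : {linear C -> k^o}) :
    {linear V ⊗ C -> V} :=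
  vlift (Bil (rscale_linl f) (rscale_linr f)).
Definition lscale (V C : lmodType k) (f : {linear C -> k^o}) :
    {linear C ⊗ V -> V} :=
  vlift (Bil (rscale_linr f) (rscale_linl f)).
End LinMaps.

Record hopf_algebra (k : fieldType) := HopfAlgebra {
  ha_alg :> algebra k;
  comul : {linear ha_alg -> tens_algebra ha_alg ha_alg};
  counit : {linear ha_alg -> algebra_of k^o};
  antipode : {linear ha_alg -> ha_alg};
  comulA : forall h,
    vassoc _ _ _ (vmap comul (lid ha_alg) (comul h))
      = vmap (lid ha_alg) comul (comul h);
  comul_counitl : forall h, lscale _ counit (comul h) = h;
  comul_counitr : forall h, rscale _ counit (comul h) = h;
  comul_morph : alg_morph comul;
  counit_morph : alg_morph counit;
  antipodel : forall h,
    amul ha_alg (vmap antipode (lid ha_alg) (comul h)) = aunit _ (counit h);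
  antipoder : forall h,
    amul ha_alg (vmap (lid ha_alg) antipode (comul h)) = aunit _ (counit h)
}.
Arguments comul {k} _.
Arguments counit {k} _.
Arguments antipode {k} _.

Definition left_integral (k : fieldType) (H : hopf_algebra k)
    (phi : {linear H -> k^o}) : Prop :=
  forall h : H, rscale _ phi (comul H h) = (phi h : k) *: alg_one.

Definition cosemisimple (k : fieldType) (H : hopf_algebra k) : Prop :=
  exists2 phi : {linear H -> k^o}, left_integral phi & phi alg_one = 1.

Record comodule_algebra (k : fieldType) (H : hopf_algebra k) :=
  ComoduleAlgebra {
  ca_alg :> algebra k;
  coact : {linear ca_alg -> tens_algebra ca_alg H};
  coactA : forall a,
    vassoc _ _ _ (vmap coact (lid H) (coact a))
      = vmap (lid ca_alg) (comul H) (coact a);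
  coact_counit : forall a, rscale _ (counit H) (coact a) = a;
  coact_morph : alg_morph coact
}.
Arguments coact {k H} _.

Definition subspace_closed (k : fieldType) (V : lmodType k) (P : V -> Prop) :=
  P 0 /\ forall (c : k) x y, P x -> P y -> P (c *: x + y).

Section Subspace.
Variables (k : fieldType) (V : lmodType k) (P : V -> Prop).
Variable hP : subspace_closed P.

Definition subspace_pred of subspace_closed P : {pred V} := fun x => `[< P x >].
Let subspace_submod : submod_closed (subspace_pred hP).
Proof.
split=> [|c x y /asboolP hx /asboolP hy]; apply/asboolP; first exact: hP.1.
exact: hP.2.
Qed.
HB.instance Definition _ :=
  GRing.isSubmodClosed.Build k V (subspace_pred hP) subspace_submod.

Record subspace : predArgType :=
  Subspace { sub_val : V; _ : sub_val \in subspace_pred hP }.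
HB.instance Definition _ := [isSub for sub_val].
HB.instance Definition _ := [Choice of subspace by <:].
HB.instance Definition _ := [SubChoice_isSubLmodule of subspace by <:].

Definition subsp : lmodType k := subspace.
Definition sub_mk (x : V) (hx : P x) : subsp :=
  @Subspace x (asboolT hx).
Lemma sub_valP (x : subsp) : P (sub_val x).
Proof. by case: x => x /= /asboolP. Qed.
Lemma sub_val_inj : injective (sub_val : subsp -> V).
Proof. exact: val_inj. Qed.
Lemma sub_val_linear : linear (sub_val : subsp -> V).
Proof. by []. Qed.
End Subspace.

Section Coinvariants.
Variables (k : fieldType) (H : hopf_algebra k) (A : comodule_algebra H).

Definition coinvariant (a : A) : Prop := coact A a = a ⊗t alg_one.

Lemma coinv_subspace : subspace_closed coinvariant.
Proof.
split=> [|c x y hx hy]; rewrite /coinvariant.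
  have := vpure_linl (alg_one : H) (-1) (0 : A) 0.
  by rewrite scaler0 addr0 linear0 scaleN1r addNr.
by rewrite linearP hx hy vpure_linl.
Qed.

Lemma coinv_one : coinvariant alg_one.
Proof. exact: (coact_morph A).1. Qed.

Lemma coinv_mul x y : coinvariant x -> coinvariant y -> coinvariant (x ∙ y).
Proof.
move=> hx hy; rewrite /coinvariant (coact_morph A).2 hx hy.
by rewrite [LHS]tmul_pure alg_mul1l.
Qed.

Let S := subsp coinv_subspace.
Let mul (x y : S) : S :=
  sub_mk coinv_subspace (coinv_mul (sub_valP x) (sub_valP y)).
Let ml y : linear (mul^~ y).
Proof. by move=> c u v; apply: sub_val_inj; rewrite /= linearPl. Qed.
Let mr x : linear (mul x).
Proof. by move=> c u v; apply: sub_val_inj; rewrite /= linearPr. Qed.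
Let mulA x y z : mul x (mul y z) = mul (mul x y) z.
Proof. by apply: sub_val_inj; rewrite /= alg_mulA. Qed.
Let one : S := sub_mk coinv_subspace coinv_one.
Let mul1l x : mul one x = x.
Proof. by apply: sub_val_inj; rewrite /= alg_mul1l. Qed.
Let mul1r x : mul x one = x.
Proof. by apply: sub_val_inj; rewrite /= alg_mul1r. Qed.

Definition coinv : algebra k := @MkAlgebra k S one (Bil ml mr) mulA mul1l mul1r.

Definition coinv_incl : {linear coinv -> A} :=
  Lin (@sub_val_linear _ _ _ coinv_subspace).
End Coinvariants.
Arguments coinv {k H} A.
Arguments coinv_incl {k H} A.

Record lincat (k : fieldType) := LinCat {
  obj :> Type;
  mor : obj -> obj -> lmodType k;
  idm : forall X, mor X X;
  mcomp : forall X Y Z, mor Y Z -> mor X Y -> mor X Z;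
  mcompA : forall X Y Z T (h : mor Z T) (g : mor Y Z) (f : mor X Y),
    mcomp h (mcomp g f) = mcomp (mcomp h g) f;
  comp1m : forall X Y (f : mor X Y), mcomp (idm Y) f = f;
  compm1 : forall X Y (f : mor X Y), mcomp f (idm X) = f;
  comp_linl : forall X Y Z (f : mor X Y), linear (fun g : mor Y Z => mcomp g f);
  comp_linr : forall X Y Z (g : mor Y Z), linear (fun f : mor X Y => mcomp g f)
}.
Arguments idm {k C} X : rename.
Arguments mor {k C} X Y : rename.
Notation "g ∘ f" := (mcomp g f) (at level 40, left associativity).

Record functor (k : fieldType) (C D : lincat k) := Functor {
  fobj :> C -> D;
  fmap : forall X Y : C, mor X Y -> mor (fobj X) (fobj Y);
  fmap1 : forall X, fmap (idm X) = idm (fobj X);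
  fmapM : forall X Y Z (g : mor Y Z) (f : mor X Y),
    fmap (g ∘ f) = fmap g ∘ fmap f
}.
Arguments fmap {k C D} F {X Y} f : rename.

Section Grothendieck.
Variables (k : fieldType) (C : lincat k).
Implicit Types X Y Z : C.

Definition is_mono X Y (f : mor X Y) :=
  forall Z (g h : mor Z X), f ∘ g = f ∘ h -> g = h.
Definition is_epi X Y (f : mor X Y) :=
  forall Z (g h : mor Y Z), g ∘ f = h ∘ f -> g = h.

Definition is_equalizer X Y (f g : mor X Y) E (e : mor E X) :=
  f ∘ e = g ∘ e /\
  forall Z (h : mor Z X), f ∘ h = g ∘ h -> exists! u : mor Z E, e ∘ u = h.
Definition is_coequalizer X Y (f g : mor X Y) Q (q : mor Y Q) :=
  q ∘ f = q ∘ g /\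
  forall Z (h : mor Y Z), h ∘ f = h ∘ g -> exists! u : mor Q Z, u ∘ q = h.

Definition is_kernel X Y (f : mor X Y) K (i : mor K X) := is_equalizer f 0 i.
Definition is_cokernel X Y (f : mor X Y) Q (q : mor Y Q) := is_coequalizer f 0 q.

Definition is_coproduct (I : Type) (X : I -> C) P (i : forall a, mor (X a) P) :=
  forall Z (f : forall a, mor (X a) Z),
    exists! u : mor P Z, forall a, u ∘ i a = f a.

Definition short_exact X Y Z (f : mor X Y) (g : mor Y Z) :=
  is_kernel g f /\ is_cokernel f g.

Record is_abelian : Prop := IsAbelian {
  ab_zero : exists O : C, forall X,
    (forall f g : mor X O, f = g) /\ (forall f g : mor O X, f = g);
  ab_biprod : forall X Y, exists P (i1 : mor X P) (i2 : mor Y P)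
    (p1 : mor P X) (p2 : mor P Y),
    [/\ p1 ∘ i1 = idm X, p2 ∘ i2 = idm Y, p1 ∘ i2 = 0, p2 ∘ i1 = 0 &
        i1 ∘ p1 + i2 ∘ p2 = idm P];
  ab_kernel : forall X Y (f : mor X Y), exists K (i : mor K X), is_kernel f i;
  ab_cokernel : forall X Y (f : mor X Y),
    exists Q (q : mor Y Q), is_cokernel f q;
  ab_mono : forall X Y (f : mor X Y), is_mono f ->
    exists Z (g : mor Y Z), is_kernel g f;
  ab_epi : forall X Y (f : mor X Y), is_epi f ->
    exists Z (g : mor Z X), is_cokernel g f
}.

Record directed_set := DirectedSet {
  ds_elt :> Type;
  ds_le : ds_elt -> ds_elt -> Prop;
  ds_refl : forall i, ds_le i i;
  ds_trans : forall i j l, ds_le i j -> ds_le j l -> ds_le i l;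
  ds_inhabited : inhabited ds_elt;
  ds_directed : forall i j, exists l, ds_le i l /\ ds_le j l
}.

Record direct_system (I : directed_set) := DirectSystem {
  dsys :> I -> C;
  dsys_map : forall i j : I, ds_le i j -> mor (dsys i) (dsys j);
  dsys_id : forall i (h : ds_le i i), dsys_map h = idm (dsys i);
  dsys_comp : forall i j l (h : ds_le i j) (h' : ds_le j l) (h'' : ds_le i l),
    dsys_map h' ∘ dsys_map h = dsys_map h''
}.

Definition is_direct_limit (I : directed_set) (D : direct_system I) L
    (c : forall i, mor (D i) L) :=
  (forall i j (h : ds_le i j), c j ∘ dsys_map D h = c i) /\
  forall Z (f : forall i, mor (D i) Z),
    (forall i j (h : ds_le i j), f j ∘ dsys_map D h = f i) ->
    exists! u : mor L Z, forall i, u ∘ c i = f i.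

Definition is_nat_trans (I : directed_set) (D D' : direct_system I)
    (a : forall i, mor (D i) (D' i)) :=
  forall i j (h : ds_le i j), a j ∘ dsys_map D h = dsys_map D' h ∘ a i.

Definition direct_limits_exact :=
  forall (I : directed_set) (D1 D2 D3 : direct_system I)
    (a : forall i, mor (D1 i) (D2 i)) (b : forall i, mor (D2 i) (D3 i)),
    is_nat_trans a -> is_nat_trans b -> (forall i, short_exact (a i) (b i)) ->
  forall L1 L2 L3 (c1 : forall i, mor (D1 i) L1) (c2 : forall i, mor (D2 i) L2)
    (c3 : forall i, mor (D3 i) L3),
    is_direct_limit c1 -> is_direct_limit c2 -> is_direct_limit c3 ->
  forall (f : mor L1 L2) (g : mor L2 L3),
    (forall i, f ∘ c1 i = c2 i ∘ a i) -> (forall i, g ∘ c2 i = c3 i ∘ b i) ->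
    short_exact f g.

Record is_grothendieck : Prop := IsGrothendieck {
  gr_abelian : is_abelian;
  gr_coproduct : forall (I : Type) (X : I -> C),
    exists P (i : forall a, mor (X a) P), is_coproduct i;
  gr_exact : direct_limits_exact;
  gr_generator : exists G : C, forall X Y (f g : mor X Y),
    (forall h : mor G X, f ∘ h = g ∘ h) -> f = g
}.
End Grothendieck.

Record grothendieck_category (k : fieldType) := GrothendieckCategory {
  gr_cat :> lincat k;
  grP : is_grothendieck gr_cat
}.

Section LinCatTheory.
Variables (k : fieldType) (C : lincat k).
Implicit Types X Y Z : C.

Lemma compDl X Y Z (g g' : mor Y Z) (f : mor X Y) :
  (g + g') ∘ f = g ∘ f + g' ∘ f.
Proof. by have := comp_linl f 1 g g'; rewrite !scale1r. Qed.
Lemma compDr X Y Z (g : mor Y Z) (f f' : mor X Y) :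
  g ∘ (f + f') = g ∘ f + g ∘ f'.
Proof. by have := comp_linr g 1 f f'; rewrite !scale1r. Qed.
Lemma comp0m X Y Z (f : mor X Y) : (0 : mor Y Z) ∘ f = 0.
Proof. by apply: (addrI (0 ∘ f)); rewrite -compDl !addr0. Qed.
Lemma compm0 X Y Z (g : mor Y Z) : g ∘ (0 : mor X Y) = 0.
Proof. by apply: (addrI (g ∘ 0)); rewrite -compDr !addr0. Qed.
Lemma compNl X Y Z (g : mor Y Z) (f : mor X Y) : (- g) ∘ f = - (g ∘ f).
Proof. by apply: (addrI (g ∘ f)); rewrite -compDl !subrr comp0m. Qed.
Lemma compNr X Y Z (g : mor Y Z) (f : mor X Y) : g ∘ (- f) = - (g ∘ f).
Proof. by apply: (addrI (g ∘ f)); rewrite -compDr !subrr compm0. Qed.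
Lemma compBl X Y Z (g g' : mor Y Z) (f : mor X Y) :
  (g - g') ∘ f = g ∘ f - g' ∘ f.
Proof. by rewrite compDl compNl. Qed.
Lemma compBr X Y Z (g : mor Y Z) (f f' : mor X Y) :
  g ∘ (f - f') = g ∘ f - g ∘ f'.
Proof. by rewrite compDr compNr. Qed.
Lemma compZr X Y Z (g : mor Y Z) c (f : mor X Y) :
  g ∘ (c *: f) = c *: (g ∘ f).
Proof. by have := comp_linr g c f 0; rewrite compm0 !addr0. Qed.
Lemma compZl X Y Z (g : mor Y Z) c (f : mor X Y) :
  (c *: g) ∘ f = c *: (g ∘ f).
Proof. by have := comp_linl f c g 0; rewrite comp0m !addr0. Qed.

Lemma compl_linear (U : lmodType k) X Y Z (f : U -> mor Y Z) (g : mor X Y) :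
  linear f -> linear (fun u => f u ∘ g).
Proof. by move=> hf a u v; rewrite hf comp_linl. Qed.
Lemma compr_linear (U : lmodType k) X Y Z (f : U -> mor X Y) (g : mor Y Z) :
  linear f -> linear (fun u => g ∘ f u).
Proof. by move=> hf a u v; rewrite hf comp_linr. Qed.
End LinCatTheory.

Section Chosen.
Variables (k : fieldType) (S : grothendieck_category k).
Implicit Types X Y Z M N : S.

Record equalizer_of X Y (f g : mor X Y) := EqualizerOf {
  eqz_obj : S; eqz_map : mor eqz_obj X; eqzP : is_equalizer f g eqz_map }.
Record coequalizer_of X Y (f g : mor X Y) := CoequalizerOf {
  coeq_obj : S; coeq_map : mor Y coeq_obj; coeqP : is_coequalizer f g coeq_map }.

Lemma equalizer_exists X Y (f g : mor X Y) : inhabited (equalizer_of f g).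
Proof.
have [K [i [h0 hi]]] := ab_kernel (gr_abelian (grP S)) (f - g).
constructor; exists K i; split.
  by apply/eqP; rewrite -subr_eq0 -compBl h0 comp0m.
move=> Z h hh; apply: hi; rewrite compBl comp0m.
by apply/eqP; rewrite subr_eq0 hh.
Qed.
Lemma coequalizer_exists X Y (f g : mor X Y) : inhabited (coequalizer_of f g).
Proof.
have [K [i [h0 hi]]] := ab_cokernel (gr_abelian (grP S)) (f - g).
constructor; exists K i; split.
  by apply/eqP; rewrite -subr_eq0 -compBr h0 compm0.
move=> Z h hh; apply: hi; rewrite compBr compm0.
by apply/eqP; rewrite subr_eq0 hh.
Qed.

(* A universal arrow from V to the functor S(M,-) : S -> k-Mod, i.e. the value
   at V of a left adjoint of that functor. Below, V ⊗ M is identified with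
   M ⊗ V, so that both are written M ⊠ V. *)
Record tensor_of M (V : lmodType k) := TensorOf {
  tens_obj : S;
  tens_in : {linear V -> mor M tens_obj};
  tens_univ : forall N (f : {linear V -> mor M N}),
    exists! u : mor tens_obj N, forall v, u ∘ tens_in v = f v
}.

Lemma tensor_exists M V : inhabited (tensor_of M V).
Proof.
have [P [i hP]] := gr_coproduct (grP S) (fun _ : V => M).
have [R [j hR]] := gr_coproduct (grP S) (fun _ : k * V * V => M).
have [r [hr _]] := hR P (fun x => i (x.1.1 *: x.1.2 + x.2)
                                  - (x.1.1 *: i x.1.2 + i x.2)).
have [Q [q [hq0 hq]]] := ab_cokernel (gr_abelian (grP S)) r.
have ql : linear (fun v => q ∘ i v).
  move=> a u v; have := congr1 (fun f => f ∘ j (a, u, v)) hq0.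
  rewrite compm0 comp0m -mcompA hr /= compBr => /eqP.
  by rewrite subr_eq0 => /eqP ->; rewrite comp_linr.
constructor; exists Q (Lin ql) => N f.
have [u [hu uu]] := hP N f.
have [|w [hw uw]] := hq N u.
  rewrite compm0.
  have [z [_ uz]] := hR N (fun _ => 0).
  transitivity z; [apply/esym|]; apply: uz => x; last by rewrite comp0m.
  by rewrite -mcompA hr compBr comp_linr !hu linearP subrr.
exists w; split=> [v|w' hw'].
  by rewrite LinE mcompA hw hu.
by apply: uw; apply/esym; apply: uu => v; rewrite -mcompA -hw'.
Qed.

Definition pick_inh (T : Type) (h : inhabited T) : T :=
  sval (cid (let: inhabits x := h in ex_intro (fun _ => True) x I)).

Definition equalizer X Y (f g : mor X Y) : equalizer_of f g :=
  pick_inh (equalizer_exists f g).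
Definition coequalizer X Y (f g : mor X Y) : coequalizer_of f g :=
  pick_inh (coequalizer_exists f g).
Definition tens_choice M V : tensor_of M V := pick_inh (tensor_exists M V).

Definition eqz_lift X Y (f g : mor X Y) Z (h : mor Z X)
    (hh : f ∘ h = g ∘ h) : mor Z (eqz_obj (equalizer f g)) :=
  sval (cid ((eqzP (equalizer f g)).2 Z h hh)).
Definition coeq_desc X Y (f g : mor X Y) Z (h : mor Y Z)
    (hh : h ∘ f = h ∘ g) : mor (coeq_obj (coequalizer f g)) Z :=
  sval (cid ((coeqP (coequalizer f g)).2 Z h hh)).

Lemma eqz_liftE X Y (f g : mor X Y) Z (h : mor Z X) hh :
  eqz_map (equalizer f g) ∘ @eqz_lift X Y f g Z h hh = h :> mor Z X.
Proof. by rewrite /eqz_lift; case: cid => u [/= hu _]. Qed.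
Lemma eqz_mono X Y (f g : mor X Y) Z (u v : mor Z (eqz_obj (equalizer f g))) :
  eqz_map (equalizer f g) ∘ u = eqz_map (equalizer f g) ∘ v -> u = v.
Proof.
move=> e; have [h0 h1] := eqzP (equalizer f g).
have [|w [_ uw]] := h1 Z (eqz_map (equalizer f g) ∘ u); first by rewrite !mcompA h0.
by rewrite -(uw u) // -(uw v).
Qed.
Lemma coeq_descE X Y (f g : mor X Y) Z (h : mor Y Z) hh :
  @coeq_desc X Y f g Z h hh ∘ coeq_map (coequalizer f g) = h :> mor Y Z.
Proof. by rewrite /coeq_desc; case: cid => u [/= hu _]. Qed.
Lemma coeq_epi X Y (f g : mor X Y) Z (u v : mor (coeq_obj (coequalizer f g)) Z) :
  u ∘ coeq_map (coequalizer f g) = v ∘ coeq_map (coequalizer f g) -> u = v.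
Proof.
move=> e; have [h0 h1] := coeqP (coequalizer f g).
have [|w [_ uw]] := h1 Z (u ∘ coeq_map (coequalizer f g)).
  by rewrite -!mcompA h0.
by rewrite -(uw u) // -(uw v).
Qed.

Definition tens M (V : lmodType k) : S := tens_obj (tens_choice M V).
Definition tin M (V : lmodType k) : {linear V -> mor M (tens M V)} :=
  tens_in (tens_choice M V).
Definition tlift M N (V : lmodType k) (f : {linear V -> mor M N}) :
    mor (tens M V) N :=
  sval (cid (tens_univ (tens_choice M V) f)).

Lemma tliftE M N (V : lmodType k) (f : {linear V -> mor M N}) v : tlift f ∘ tin M V v = f v.
Proof. by rewrite /tlift; case: cid => u [/= hu _]; rewrite hu. Qed.
Lemma tens_ext M N (V : lmodType k) (u v : mor (tens M V) N) :
  (forall x, u ∘ tin M V x = v ∘ tin M V x) -> u = v.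
Proof.
move=> h.
have l : linear (fun x => v ∘ tin M V x) by apply: compr_linear; apply: linearP.
have [w [_ uw]] := tens_univ (tens_choice M V) (Lin l).
by rewrite -(uw u) // -(uw v).
Qed.
Lemma tlift_linear (U V : lmodType k) M N (f : U -> {linear V -> mor M N}) :
  (forall v, linear (f^~ v)) -> linear (fun u => tlift (f u)).
Proof.
move=> hf a u v; apply: tens_ext => x.
by rewrite compDl compZl !tliftE hf.
Qed.
End Chosen.
Notation "M ⊠ V" := (tens M V) (at level 40, left associativity).
Arguments tin {k S M V}.

Section TensMaps.
Variables (k : fieldType) (S : grothendieck_category k).
Implicit Types (M N X : S) (U V W : lmodType k).

Lemma tmap_linear M N V W (f : mor M N) (g : {linear V -> W}) :
  linear (fun v => (tin (g v) : mor N (N ⊠ W)) ∘ f).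
Proof. by apply: compl_linear => a u v; rewrite !linearP. Qed.
Definition tmap M N V W (f : mor M N) (g : {linear V -> W}) :
  mor (M ⊠ V) (N ⊠ W) := tlift (Lin (tmap_linear f g)).
Lemma tmapE M N V W (f : mor M N) (g : {linear V -> W}) v :
  tmap f g ∘ tin v = tin (g v) ∘ f.
Proof. exact: tliftE. Qed.

Section Uncurry.
Variables (V W : lmodType k) (M N : S) (F : {bilinear V -> W -> mor M N}).
Let Fr v : {linear W -> mor M N} := F v.
Lemma tlift2_linear : linear (fun v => tlift (Fr v)).
Proof. by apply: tlift_linear => w a u v; exact: linearPl. Qed.
(* The morphism V ⊗ (W ⊗ M) -> N given by v ⊗ (w ⊗ m) |-> F v w m. *)
Definition tlift2 : mor (M ⊠ W ⊠ V) N := tlift (Lin tlift2_linear).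
Lemma tlift2E v w : tlift2 ∘ tin v ∘ tin w = F v w.
Proof. by rewrite tliftE LinE tliftE. Qed.
End Uncurry.

Lemma tens2_ext M N V W (u v : mor (M ⊠ W ⊠ V) N) :
  (forall x y, u ∘ tin x ∘ tin y = v ∘ tin x ∘ tin y) -> u = v.
Proof. by move=> h; apply: tens_ext => x; apply: tens_ext => y. Qed.

Section Canonical.
Variables (M : S) (V W : lmodType k).

(* V ⊗ (W ⊗ M) -> (V ⊗ W) ⊗ M *)
Let Ll w : linear (fun v => tin (v ⊗t w) : mor M (M ⊠ (V ⊗ W))).
Proof. by move=> a u v; rewrite vpure_linl linearP. Qed.
Let Lr v : linear (fun w => tin (v ⊗t w) : mor M (M ⊠ (V ⊗ W))).
Proof. by move=> a u w; rewrite vpure_linr linearP. Qed.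
Definition lassoc : mor (M ⊠ W ⊠ V) (M ⊠ (V ⊗ W)) := tlift2 (Bil Ll Lr).
Lemma lassocE v w : lassoc ∘ tin v ∘ tin w = tin (v ⊗t w).
Proof. exact: tlift2E. Qed.

(* (M ⊗ V) ⊗ W -> M ⊗ (V ⊗ W) *)
Definition rassoc : mor (M ⊠ V ⊠ W) (M ⊠ (V ⊗ W)) := tlift2 (Bil Lr Ll).
Lemma rassocE v w : rassoc ∘ tin w ∘ tin v = tin (v ⊗t w).
Proof. exact: tlift2E. Qed.
End Canonical.

(* (V ⊗ W) ⊗ M -> (V ⊗ M) ⊗ W *)
Section Shuffle.
Variables (M : S) (V W : lmodType k).
Let F v w : mor M (M ⊠ V ⊠ W) := tin w ∘ tin v.
Let Fl w : linear (F^~ w).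
Proof. by apply: compr_linear; apply: linearP. Qed.
Let Fr v : linear (F v).
Proof. by apply: compl_linear; apply: linearP. Qed.
Definition shuffle : mor (M ⊠ (V ⊗ W)) (M ⊠ V ⊠ W) := tlift (vlift (Bil Fl Fr)).
Lemma shuffleE v w : shuffle ∘ tin (v ⊗t w) = tin w ∘ tin v.
Proof. by rewrite tliftE vlift_pure. Qed.
End Shuffle.

(* V ⊗ T ⊗ W' : (V ⊗ W) ⊗ (M ⊗ W') -> (V ⊗ M) ⊗ (W ⊗ W') *)
Section Interchange.
Variables (M : S) (V W W' : lmodType k).
Let G (v : V) (w : W) (w' : W') : mor M (M ⊠ V ⊠ (W ⊗ W')) :=
  tin (w ⊗t w') ∘ tin v.
Let G_linear v w : linear (G v w).
Proof. by apply: compl_linear => a x y; rewrite vpure_linr linearP. Qed.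
Let F v w : mor (M ⊠ W') (M ⊠ V ⊠ (W ⊗ W')) := tlift (Lin (@G_linear v w)).
Let Fl w : linear (F^~ w).
Proof. by apply: tlift_linear => x; apply: compr_linear; apply: linearP. Qed.
Let Fr v : linear (F v).
Proof.
apply: tlift_linear => x; apply: compl_linear => a y z.
by rewrite vpure_linl linearP.
Qed.
Definition middle_swap :
    mor (M ⊠ W' ⊠ (V ⊗ W)) (M ⊠ V ⊠ (W ⊗ W')) :=
  tlift (vlift (Bil Fl Fr)).
Lemma middle_swapE v w w' :
  middle_swap ∘ tin (v ⊗t w) ∘ tin w' = tin (w ⊗t w') ∘ tin v.
Proof. by rewrite tliftE vlift_pure tliftE. Qed.
End Interchange.

(* M = M ⊗ k *)
Definition tunit M : mor M (M ⊠ (k^o : lmodType k)) := tin (1 : k^o).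
End TensMaps.
Arguments lassoc {k S}.
Arguments rassoc {k S}.
Arguments shuffle {k S}.
Arguments middle_swap {k S}.
Arguments tunit {k S}.

Local Ltac lin := repeat first
  [ exact: linearP
  | apply: compl_linear
  | apply: compr_linear
  | by move=> ? ? ?; rewrite !linearP ].

Lemma vtens_lin_ext (k : fieldType) (V W U : lmodType k) (f g : V ⊗ W -> U) :
  linear f -> linear g -> (forall v w, f (v ⊗t w) = g (v ⊗t w)) -> f =1 g.
Proof. by move=> hf hg h x; exact: (@vtens_ext _ _ _ _ (Lin hf) (Lin hg)). Qed.

Section TMapTheory.
Variables (k : fieldType) (S : grothendieck_category k).
Implicit Types (M N X : S) (U V W : lmodType k).

Lemma tmap1 M V : tmap (idm M) (lid V) = idm (M ⊠ V).
Proof. by apply: tens_ext => x; rewrite tmapE compm1 comp1m. Qed.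
Lemma tmap_comp M N X V (g : mor N X) (f : mor M N) :
  tmap (g ∘ f) (lid V) = tmap g (lid V) ∘ tmap f (lid V).
Proof. by apply: tens_ext => x; rewrite -mcompA !tmapE !mcompA tmapE. Qed.
Lemma tmap_linearl M N V W (g : {linear V -> W}) :
  linear (fun f : mor M N => tmap f g).
Proof.
move=> a u v; apply: tens_ext => x.
by rewrite compDl compZl !tmapE comp_linr.
Qed.

(* M ⊗ u_R : M = M ⊗ k -> M ⊗ R *)
Definition unit_map (R : algebra k) M : mor M (M ⊠ R) :=
  tmap (idm M) (aunit R) ∘ tunit M.
Lemma unit_mapE (R : algebra k) M : unit_map R M = tin alg_one.
Proof. by rewrite /unit_map tmapE compm1 LinE scale1r. Qed.
End TMapTheory.

Section LeftModules.
Variables (k : fieldType) (S : grothendieck_category k) (R : algebra k).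

Definition is_lmodule (M : S) (mu : mor (M ⊠ R) M) : Prop :=
  mu ∘ tmap mu (lid R) = mu ∘ tmap (idm M) (amul R) ∘ lassoc M R R /\
  mu ∘ unit_map R M = idm M.

Lemma is_lmoduleP (M : S) (mu : mor (M ⊠ R) M) : is_lmodule mu <->
  (forall a b, mu ∘ tin a ∘ (mu ∘ tin b) = mu ∘ tin (a ∙ b)) /\
  mu ∘ tin alg_one = idm M.
Proof.
rewrite /is_lmodule unit_mapE.
have e1 a b : mu ∘ tmap mu (lid R) ∘ tin a ∘ tin b
              = mu ∘ tin a ∘ (mu ∘ tin b).
  by rewrite -(mcompA mu) tmapE LinE !mcompA.
have e2 a b : mu ∘ tmap (idm M) (amul R) ∘ lassoc M R R ∘ tin a ∘ tin b
              = mu ∘ tin (a ∙ b).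
  by rewrite -!mcompA (mcompA (lassoc _ _ _)) lassocE tmapE amul_pure compm1.
split=> -[h1 h2]; split=> //.
  by move=> a b; rewrite -e1 h1 e2.
by apply: tens2_ext => a b; rewrite e1 e2 h1.
Qed.

Record lmodule := LModule {
  lm_obj :> S;
  lm_act : mor (lm_obj ⊠ R) lm_obj;
  lm_axiom : is_lmodule lm_act
}.

Definition is_lmod_hom (M N : S) (mu : mor (M ⊠ R) M) (nu : mor (N ⊠ R) N)
    (f : mor M N) : Prop := f ∘ mu = nu ∘ tmap f (lid R).

Lemma is_lmod_homP M N mu nu f : @is_lmod_hom M N mu nu f <->
  forall a, f ∘ (mu ∘ tin a) = nu ∘ tin a ∘ f.
Proof.
rewrite /is_lmod_hom; split=> [h a|h].
  by rewrite mcompA h -mcompA tmapE LinE mcompA.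
by apply: tens_ext => a; rewrite -mcompA h -!mcompA tmapE LinE.
Qed.

Lemma lmod_hom_closed M N mu nu : subspace_closed (@is_lmod_hom M N mu nu).
Proof.
split; first by apply/is_lmod_homP => a; rewrite comp0m compm0.
move=> c f g /is_lmod_homP hf /is_lmod_homP hg; apply/is_lmod_homP => a.
by rewrite compDl compZl hf hg compDr compZr.
Qed.

Lemma lmod_hom1 M mu : @is_lmod_hom M M mu mu (idm M).
Proof. by apply/is_lmod_homP => a; rewrite comp1m compm1. Qed.
Lemma lmod_hom_comp M N X mu nu xi f g :
  @is_lmod_hom N X nu xi g -> @is_lmod_hom M N mu nu f ->
  is_lmod_hom mu xi (g ∘ f).
Proof.
move=> /is_lmod_homP hg /is_lmod_homP hf; apply/is_lmod_homP => a.
by rewrite -mcompA hf mcompA hg mcompA.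
Qed.

Section Cat.
Implicit Types M N X : lmodule.
Definition lmod_hom M N : lmodType k :=
  subsp (@lmod_hom_closed M N (lm_act M) (lm_act N)).
Definition lmod_id M : lmod_hom M M := sub_mk _ (lmod_hom1 (lm_act M)).
Definition lmod_comp M N X (g : lmod_hom N X) (f : lmod_hom M N) :
    lmod_hom M X :=
  sub_mk _ (lmod_hom_comp (sub_valP g) (sub_valP f)).

Definition lmod_cat : lincat k.
Proof.
refine (@LinCat k lmodule lmod_hom lmod_id lmod_comp _ _ _ _ _).
- by move=> X Y Z T h g f; apply: sub_val_inj; apply: mcompA.
- by move=> X Y f; apply: sub_val_inj; apply: comp1m.
- by move=> X Y f; apply: sub_val_inj; apply: compm1.
- by move=> X Y Z f a u v; apply: sub_val_inj; apply: comp_linl.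
- by move=> X Y Z g a u v; apply: sub_val_inj; apply: comp_linr.
Defined.
End Cat.
End LeftModules.
Arguments lm_act {k S R}.

Section HopfModules.
Variables (k : fieldType) (S : grothendieck_category k) (H : hopf_algebra k).
Variable A : comodule_algebra H.

Definition is_rcomodule (M : S) (D : mor M (M ⊠ H)) : Prop :=
  rassoc M H H ∘ tmap D (lid H) ∘ D = tmap (idm M) (comul H) ∘ D /\
  tmap (idm M) (counit H) ∘ D = tunit M.

Definition is_hopf_compatible (M : S) (mu : mor (M ⊠ A) M)
    (D : mor M (M ⊠ H)) : Prop :=
  D ∘ mu = tmap mu (amul H) ∘ middle_swap M A H H ∘ tmap D (coact A).

Definition diag_act (M : S) (mu : mor (M ⊠ A) M) (x : A ⊗ H) :
    mor (M ⊠ H) (M ⊠ H) :=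
  tmap mu (amul H) ∘ (middle_swap M A H H ∘ tin x).

Lemma diag_act_linear M mu : linear (@diag_act M mu).
Proof. by lin. Qed.

Lemma diag_actE M mu a h h' :
  @diag_act M mu (a ⊗t h) ∘ tin h' = tin (h ∙ h') ∘ (mu ∘ tin a).
Proof.
rewrite /diag_act -(mcompA (tmap _ _)) middle_swapE !mcompA tmapE.
by rewrite amul_pure.
Qed.

Lemma hopf_compatibleP M mu D : @is_hopf_compatible M mu D <->
  forall a, D ∘ (mu ∘ tin a) = diag_act mu (coact A a) ∘ D.
Proof.
rewrite /is_hopf_compatible /diag_act; split=> [h a|h].
  by rewrite mcompA h -!mcompA tmapE !mcompA.
by apply: tens_ext => a; rewrite -mcompA h -!mcompA tmapE.
Qed.

Record hopf_module := HopfModule {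
  hm_obj :> S;
  hm_act : mor (hm_obj ⊠ A) hm_obj;
  hm_coact : mor hm_obj (hm_obj ⊠ H);
  hm_lmodule : is_lmodule hm_act;
  hm_rcomodule : is_rcomodule hm_coact;
  hm_compatible : is_hopf_compatible hm_act hm_coact
}.

Definition is_rcomod_hom (M N : S) (D : mor M (M ⊠ H)) (E : mor N (N ⊠ H))
    (f : mor M N) : Prop := E ∘ f = tmap f (lid H) ∘ D.

Definition is_hopf_hom (M N : hopf_module) (f : mor M N) : Prop :=
  is_lmod_hom (hm_act M) (hm_act N) f /\
  is_rcomod_hom (hm_coact M) (hm_coact N) f.

Section Cat.
Implicit Types M N X : hopf_module.

Lemma hopf_hom_closed M N : subspace_closed (@is_hopf_hom M N).
Proof.
have [l0 l1] := lmod_hom_closed (hm_act M) (hm_act N).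
split; first split=> //.
  rewrite /is_rcomod_hom compm0 (_ : tmap 0 _ = 0) ?comp0m //.
  by apply: tens_ext => x; rewrite tmapE comp0m compm0.
move=> c f g [hf hf'] [hg hg']; split; first exact: l1.
by rewrite /is_rcomod_hom comp_linr tmap_linearl compDl compZl hf' hg'.
Qed.

Lemma hopf_hom1 M : is_hopf_hom (idm M).
Proof.
split; first exact: lmod_hom1.
by rewrite /is_rcomod_hom tmap1 comp1m compm1.
Qed.
Lemma hopf_hom_comp M N X (g : mor N X) (f : mor M N) :
  is_hopf_hom g -> is_hopf_hom f -> @is_hopf_hom M X (g ∘ f).
Proof.
move=> [hg hg'] [hf hf']; split; first exact: lmod_hom_comp hg hf.
by rewrite /is_rcomod_hom mcompA hg' -mcompA hf' mcompA tmap_comp.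
Qed.

Definition hopf_hom M N : lmodType k := subsp (@hopf_hom_closed M N).
Definition hopf_id M : hopf_hom M M := sub_mk _ (hopf_hom1 M).
Definition hopf_comp M N X (g : hopf_hom N X) (f : hopf_hom M N) :
    hopf_hom M X :=
  sub_mk _ (hopf_hom_comp (sub_valP g) (sub_valP f)).

Definition hopf_cat : lincat k.
Proof.
refine (@LinCat k hopf_module hopf_hom hopf_id hopf_comp _ _ _ _ _).
- by move=> X Y Z T h g f; apply: sub_val_inj; apply: mcompA.
- by move=> X Y f; apply: sub_val_inj; apply: comp1m.
- by move=> X Y f; apply: sub_val_inj; apply: compm1.
- by move=> X Y Z f a u v; apply: sub_val_inj; apply: comp_linl.
- by move=> X Y Z g a u v; apply: sub_val_inj; apply: comp_linr.
Defined.
End Cat.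

Section Coinvariants.
Implicit Types N : hopf_module.

Definition coinv_eqz N := equalizer (unit_map H N) (hm_coact N).
Definition coinv_obj N : S := eqz_obj (coinv_eqz N).
Definition coinv_map N : mor (coinv_obj N) N := eqz_map (coinv_eqz N).

Lemma coinv_mono N Z (u v : mor Z (coinv_obj N)) :
  coinv_map N ∘ u = coinv_map N ∘ v -> u = v.
Proof. exact: eqz_mono. Qed.

Lemma coinv_mapE N : tin alg_one ∘ coinv_map N = hm_coact N ∘ coinv_map N.
Proof. by rewrite -unit_mapE; exact: (eqzP (coinv_eqz N)).1. Qed.

Lemma coinv_act_subproof N :
  unit_map H N ∘ (hm_act N ∘ tmap (coinv_map N) (coinv_incl A))
  = hm_coact N ∘ (hm_act N ∘ tmap (coinv_map N) (coinv_incl A)).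
Proof.
apply: tens_ext => b; rewrite unit_mapE -!mcompA tmapE.
have /hopf_compatibleP h := hm_compatible N.
have hb : coact A (coinv_incl A b) = coinv_incl A b ⊗t alg_one.
  exact: (sub_valP b).
rewrite (mcompA (hm_act N)) (mcompA (hm_coact N)) h hb -(mcompA (diag_act _ _)) -coinv_mapE.
by rewrite (mcompA (diag_act _ _)) diag_actE alg_mul1l !mcompA.
Qed.
Definition coinv_act N : mor (coinv_obj N ⊠ coinv A) (coinv_obj N) :=
  eqz_lift (coinv_act_subproof N).
Lemma coinv_actE N : coinv_map N ∘ coinv_act N
  = hm_act N ∘ tmap (coinv_map N) (coinv_incl A).
Proof. exact: eqz_liftE. Qed.

Lemma coinv_act_el N b : coinv_map N ∘ (coinv_act N ∘ tin b)
  = hm_act N ∘ tin (coinv_incl A b) ∘ coinv_map N.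
Proof. by rewrite mcompA coinv_actE -!mcompA tmapE. Qed.

Lemma coinv_act_lmodule N : is_lmodule (coinv_act N).
Proof.
have /is_lmoduleP[h1 h2] := hm_lmodule N.
apply/is_lmoduleP; split=> [a b|]; apply: coinv_mono.
  rewrite mcompA coinv_act_el -mcompA coinv_act_el mcompA.
  by rewrite h1 coinv_act_el.
by rewrite coinv_act_el h2 comp1m compm1.
Qed.
Definition coinv_lmodule N : lmod_cat S (coinv A) :=
  LModule (coinv_act_lmodule N).

Lemma coinv_hom_subproof N N' (f : hopf_hom N N') :
  unit_map H N' ∘ (sub_val f ∘ coinv_map N)
  = hm_coact N' ∘ (sub_val f ∘ coinv_map N).
Proof.
have [_ hf] := sub_valP f.
rewrite unit_mapE (mcompA (hm_coact N')) hf -mcompA -coinv_mapE !mcompA.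
by rewrite tmapE LinE.
Qed.
Definition coinv_hom_map N N' (f : hopf_hom N N') :
    mor (coinv_obj N) (coinv_obj N') :=
  eqz_lift (coinv_hom_subproof f).
Lemma coinv_hom_mapE N N' (f : hopf_hom N N') :
  coinv_map N' ∘ coinv_hom_map f = sub_val f ∘ coinv_map N.
Proof. exact: eqz_liftE. Qed.
Lemma coinv_hom_lmod N N' (f : hopf_hom N N') :
  is_lmod_hom (coinv_act N) (coinv_act N') (coinv_hom_map f).
Proof.
have [/is_lmod_homP hf _] := sub_valP f.
apply/is_lmod_homP => a; apply: coinv_mono.
rewrite mcompA coinv_hom_mapE -mcompA coinv_act_el mcompA hf.
by rewrite [RHS]mcompA coinv_act_el -mcompA -[RHS]mcompA coinv_hom_mapE.
Qed.

Definition coinv_functor : functor hopf_cat (lmod_cat S (coinv A)).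
Proof.
refine (@Functor k hopf_cat (lmod_cat S (coinv A)) coinv_lmodule
  (fun N N' f => sub_mk _ (coinv_hom_lmod f)) _ _).
- move=> N; apply: sub_val_inj; apply: coinv_mono.
  by rewrite coinv_hom_mapE comp1m compm1.
- move=> X Y Z g f; apply: sub_val_inj; apply: coinv_mono.
  rewrite [LHS]coinv_hom_mapE /= mcompA coinv_hom_mapE.
  by rewrite -!mcompA coinv_hom_mapE.
Defined.
End Coinvariants.

Section Induction.
Let B := coinv A.

(* a ⊗ b |-> ab *)
Definition right_mul : {linear A ⊗ B -> A} :=
  amul A \o vmap (lid A) (coinv_incl A).
Lemma right_mulE a b : right_mul (a ⊗t b) = a ∙ coinv_incl A b.
Proof. by rewrite /right_mul /= vmap_pure amul_pure. Qed.

Section Object.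
Variable M : lmodule S B.

(* A ⊗_B M is the coequalizer of the actions of B on M and on A. *)
Definition ind_coeq :=
  coequalizer (tmap (lm_act M) (lid A)) (tmap (idm M) right_mul ∘ lassoc M A B).
Definition ind_obj : S := coeq_obj ind_coeq.
Definition ind_map : mor (M ⊠ A) ind_obj := coeq_map ind_coeq.

Definition ind_in (a : A) : mor M ind_obj := ind_map ∘ tin a.

Lemma ind_in_linear : linear ind_in.
Proof. by lin. Qed.

Lemma ind_eq1 X (g : mor (M ⊠ A) X) a b :
  g ∘ tmap (lm_act M) (lid A) ∘ tin a ∘ tin b
  = g ∘ tin a ∘ (lm_act M ∘ tin b).
Proof. by rewrite -(mcompA g) tmapE LinE !mcompA. Qed.
Lemma ind_eq2 X (g : mor (M ⊠ A) X) a b :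
  g ∘ (tmap (idm M) right_mul ∘ lassoc M A B) ∘ tin a ∘ tin b
  = g ∘ tin (a ∙ coinv_incl A b).
Proof.
rewrite -!mcompA (mcompA (lassoc _ _ _)) lassocE tmapE right_mulE.
by rewrite compm1.
Qed.

Lemma ind_in_balanced a b :
  ind_in (a ∙ coinv_incl A b) = ind_in a ∘ (lm_act M ∘ tin b).
Proof. by rewrite /ind_in -ind_eq2 -ind_eq1 (coeqP ind_coeq).1. Qed.

Lemma ind_ext X (u v : mor ind_obj X) :
  (forall a, u ∘ ind_in a = v ∘ ind_in a) -> u = v.
Proof.
move=> h; apply: coeq_epi; apply: tens_ext => a.
by rewrite -!mcompA; apply: h.
Qed.

Lemma ind_desc_subproof X (g : mor (M ⊠ A) X) :
  (forall a b,
     g ∘ tin (a ∙ coinv_incl A b) = g ∘ tin a ∘ (lm_act M ∘ tin b)) ->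
  g ∘ tmap (lm_act M) (lid A)
  = g ∘ (tmap (idm M) right_mul ∘ lassoc M A B).
Proof. by move=> h; apply: tens2_ext => a b; rewrite ind_eq1 ind_eq2 h. Qed.

Lemma ind_lmul_linear (a : A) : linear (fun a' => ind_in (a ∙ a')).
Proof. by move=> c x y; rewrite linearPr ind_in_linear. Qed.
Lemma ind_lmul_subproof (a : A) :
  tlift (Lin (ind_lmul_linear a)) ∘ tmap (lm_act M) (lid A)
  = tlift (Lin (ind_lmul_linear a))
    ∘ (tmap (idm M) right_mul ∘ lassoc M A B).
Proof.
apply: ind_desc_subproof => a' b.
by rewrite !tliftE !LinE alg_mulA ind_in_balanced.
Qed.
(* Left multiplication by a on A ⊗_B M. *)
Definition ind_lmul (a : A) : mor ind_obj ind_obj :=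
  coeq_desc (ind_lmul_subproof a).
Lemma ind_lmulE a a' : ind_lmul a ∘ ind_in a' = ind_in (a ∙ a').
Proof. by rewrite mcompA coeq_descE tliftE. Qed.
Lemma ind_lmul_lin : linear ind_lmul.
Proof.
move=> c a a'; apply: ind_ext => x.
by rewrite compDl compZl !ind_lmulE linearPl ind_in_linear.
Qed.

Definition ind_act : mor (ind_obj ⊠ A) ind_obj := tlift (Lin ind_lmul_lin).
Lemma ind_act_el a : ind_act ∘ tin a = ind_lmul a.
Proof. exact: tliftE. Qed.

Lemma ind_actE : ind_act ∘ tmap ind_map (lid A)
  = ind_map ∘ (tmap (idm M) (amul A) ∘ lassoc M A A).
Proof.
apply: tens2_ext => a b.
rewrite -(mcompA ind_act) tmapE mcompA ind_act_el LinE -mcompA ind_lmulE.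
by rewrite -!mcompA (mcompA (lassoc _ _ _)) lassocE tmapE amul_pure compm1.
Qed.

Lemma ind_act_lmodule : is_lmodule ind_act.
Proof.
apply/is_lmoduleP; split=> [a b|]; apply: ind_ext => x.
  by rewrite !ind_act_el -mcompA !ind_lmulE alg_mulA.
by rewrite ind_act_el ind_lmulE alg_mul1l comp1m.
Qed.

Definition ind_tin (V : lmodType k) (x : A ⊗ V) : mor M (ind_obj ⊠ V) :=
  tmap ind_map (lid V) ∘ shuffle M A V ∘ tin x.
Lemma ind_tin_linear V : linear (@ind_tin V).
Proof. by lin. Qed.
Lemma ind_tinE V a v : @ind_tin V (a ⊗t v) = tin v ∘ ind_in a.
Proof. by rewrite /ind_tin -mcompA shuffleE mcompA tmapE LinE mcompA. Qed.

Lemma ind_tin_balanced (x : tens_algebra A H) b :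
  ind_tin (x ∙ (coinv_incl A b ⊗t alg_one))
  = ind_tin x ∘ (lm_act M ∘ tin b).
Proof.
apply: (vtens_lin_ext
  (f := fun x : tens_algebra A H =>
     ind_tin ((x : tens_algebra A H) ∙ (coinv_incl A b ⊗t alg_one)))
  (g := fun x => ind_tin x ∘ (lm_act M ∘ tin b))).
- by move=> c y z; rewrite linearPl ind_tin_linear.
- by apply: compl_linear; apply: ind_tin_linear.
move=> a h; rewrite [X in ind_tin X]tmul_pure !ind_tinE ind_in_balanced.
by rewrite alg_mul1r mcompA.
Qed.

Lemma ind_coact_subproof :
  tmap ind_map (lid H) ∘ shuffle M A H ∘ tmap (idm M) (coact A)
    ∘ tmap (lm_act M) (lid A)
  = tmap ind_map (lid H) ∘ shuffle M A H ∘ tmap (idm M) (coact A)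
    ∘ (tmap (idm M) right_mul ∘ lassoc M A B).
Proof.
apply: ind_desc_subproof => a b.
rewrite -!(mcompA _ (tmap (idm M) _)) !tmapE !compm1.
rewrite (coact_morph A).2 (_ : coact A (coinv_incl A b) = coinv_incl A b ⊗t alg_one).
  exact: ind_tin_balanced.
exact: (sub_valP b).
Qed.
(* The map induced by a ⊗ m |-> (a_0 ⊗ m) ⊗ a_1. *)
Definition ind_coact : mor ind_obj (ind_obj ⊠ H) :=
  coeq_desc ind_coact_subproof.
Lemma ind_coact_el a : ind_coact ∘ ind_in a = ind_tin (coact A a).
Proof.
by rewrite mcompA coeq_descE -mcompA tmapE compm1.
Qed.

Lemma ind_rcomodule : is_rcomodule ind_coact.
Proof.
split; apply: ind_ext => a; rewrite -!mcompA ind_coact_el.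
  have h1 x : rassoc ind_obj H H ∘ (tmap ind_coact (lid H) ∘ ind_tin x)
      = ind_tin (vassoc _ _ _ (vmap (coact A) (lid H) x)).
    move: x; apply: vtens_lin_ext.
    - by do 2 apply: compr_linear; apply: ind_tin_linear.
    - by move=> c x y; rewrite !linearP ind_tin_linear.
    move=> a' h; rewrite vmap_pure ind_tinE [X in _ ∘ X]mcompA tmapE LinE.
    rewrite -mcompA ind_coact_el.
    move: (coact A a'); apply: vtens_lin_ext.
    - by do 2 apply: compr_linear; apply: ind_tin_linear.
    - by move=> c x y; rewrite vpure_linl linearP ind_tin_linear.
    by move=> v w; rewrite vassoc_pure !ind_tinE !mcompA rassocE.
  have h2 x : tmap (idm ind_obj) (comul H) ∘ ind_tin x
      = ind_tin (vmap (lid A) (comul H) x).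
    move: x; apply: vtens_lin_ext.
    - by apply: compr_linear; apply: ind_tin_linear.
    - by move=> c x y; rewrite linearP ind_tin_linear.
    by move=> v w; rewrite vmap_pure !ind_tinE mcompA tmapE compm1.
  by rewrite h1 h2 coactA.
have h x : tmap (idm ind_obj) (counit H) ∘ ind_tin x
    = tunit ind_obj ∘ ind_in (rscale _ (counit H) x).
  move: x; apply: vtens_lin_ext.
  - by apply: compr_linear; apply: ind_tin_linear.
  - by apply: compr_linear => c x y; rewrite linearP ind_in_linear.
  move=> a' h; rewrite ind_tinE mcompA tmapE compm1 vlift_pure BilE.
  have -> : ind_in ((counit H h : k) *: a') = (counit H h : k) *: ind_in a'.
    exact: (linearZ_LR (Lin ind_in_linear)).
  rewrite compZr -compZl /tunit; congr (_ ∘ _).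
  by rewrite -linearZ_LR; congr (tin _); exact: (esym (mulr1 (counit H h : k))).
by rewrite h coact_counit.
Qed.

Lemma ind_compatible : is_hopf_compatible ind_act ind_coact.
Proof.
apply/hopf_compatibleP => a; apply: ind_ext => a'.
rewrite ind_act_el -(mcompA ind_coact) ind_lmulE -(mcompA (diag_act _ _)).
rewrite !ind_coact_el (coact_morph A).2.
move: (coact A a); apply: vtens_lin_ext.
- by move=> c x y; rewrite linearPl ind_tin_linear.
- by apply: compl_linear; apply: diag_act_linear.
move=> u h; move: (coact A a'); apply: vtens_lin_ext.
- by move=> c x y; rewrite linearPr ind_tin_linear.
- by apply: compr_linear; apply: ind_tin_linear.
move=> u' h'; rewrite [X in ind_tin X]tmul_pure !ind_tinE mcompA diag_actE.
by rewrite ind_act_el -mcompA ind_lmulE.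
Qed.

Definition ind_hopf_module : hopf_cat :=
  HopfModule ind_act_lmodule ind_rcomodule ind_compatible.
End Object.

Section Map.
Variables (M M' : lmodule S B) (f : lmod_hom M M').

Lemma ind_hom_subproof :
  ind_map M' ∘ tmap (sub_val f) (lid A) ∘ tmap (lm_act M) (lid A)
  = ind_map M' ∘ tmap (sub_val f) (lid A)
    ∘ (tmap (idm M) right_mul ∘ lassoc M A B).
Proof.
have /is_lmod_homP hf := sub_valP f.
apply: ind_desc_subproof => a b.
rewrite -!(mcompA (ind_map M')) !tmapE !LinE !(mcompA (ind_map M')).
rewrite -/(ind_in M' _) -/(ind_in M' a) ind_in_balanced -!mcompA.
by congr (_ ∘ (_ ∘ _)); rewrite hf mcompA.
Qed.
Definition ind_hom_map : mor (ind_obj M) (ind_obj M') :=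
  coeq_desc ind_hom_subproof.
Lemma ind_hom_mapE a : ind_hom_map ∘ ind_in M a = ind_in M' a ∘ sub_val f.
Proof. by rewrite mcompA coeq_descE -mcompA tmapE LinE mcompA. Qed.

Lemma ind_hom_hopf :
  @is_hopf_hom (ind_hopf_module M) (ind_hopf_module M') ind_hom_map.
Proof.
split.
  apply/is_lmod_homP => a; apply: ind_ext => x /=.
  by rewrite !ind_act_el -!mcompA ind_lmulE !ind_hom_mapE mcompA ind_lmulE.
apply: ind_ext => a /=.
rewrite -!mcompA ind_hom_mapE ind_coact_el mcompA ind_coact_el.
move: (coact A a); apply: vtens_lin_ext.
- by apply: compl_linear; apply: ind_tin_linear.
- by apply: compr_linear; apply: ind_tin_linear.
move=> u h; rewrite !ind_tinE [RHS]mcompA tmapE LinE.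
by rewrite -[RHS]mcompA ind_hom_mapE [RHS]mcompA.
Qed.
End Map.

Definition ind_functor : functor (lmod_cat S B) hopf_cat.
Proof.
refine (@Functor k (lmod_cat S B) hopf_cat ind_hopf_module
  (fun M M' f => sub_mk _ (ind_hom_hopf f)) _ _).
- move=> M; apply: sub_val_inj; apply: ind_ext => a.
  by rewrite [LHS]ind_hom_mapE /= compm1 comp1m.
- move=> X Y Z g f; apply: sub_val_inj; apply: ind_ext => a.
  rewrite [LHS]ind_hom_mapE /= -[RHS]mcompA ind_hom_mapE mcompA.
  by rewrite mcompA ind_hom_mapE.
Defined.
End Induction.
End HopfModules.

(* Main.v *)
Require Import Defs.
From mathcomp Require Import all_boot all_order all_algebra.

Set Implicit Arguments.
Unset Strict Implicit.
Unset Printing Implicit Defensive.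

Local Open Scope ring_scope.

(* The usual adjunction: f : A ⊗_B M -> N goes to m |-> f (1 ⊗ m), which lands in
   the coinvariants because f is H-colinear and 1 ⊗ m is coinvariant, and
   g : M -> N^coH goes to a ⊗ m |-> a g(m). As f is A-linear, it is determined
   by its values on the 1 ⊗ m, so the two are mutually inverse. *)

Section Adjunction.
Variables (k : fieldType) (S : grothendieck_category k) (H : hopf_algebra k).
Variable A : comodule_algebra H.
Implicit Types (M : lmod_cat S (coinv A)) (N : hopf_cat S A).

(** In element notation, [a ⊗ m = a (1 ⊗ m)], and [f] commutes with the action of [A]. *)
Lemma hom_ind_in M N (f : mor (ind_functor S A M) N) a :
  sub_val f ∘ ind_in M a
  = hm_act N ∘ tin a ∘ (sub_val f ∘ ind_in M alg_one).
Proof.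
have [/is_lmod_homP hf _] := sub_valP f.
have {hf} := hf a; rewrite /= ind_act_el => hf.
by rewrite mcompA -hf -mcompA ind_lmulE alg_mul1r.
Qed.

Section ToCoinvariants.
Variables (M : lmod_cat S (coinv A)) (N : hopf_cat S A).

Lemma ind_transpose_subproof (f : mor (ind_functor S A M) N) :
  unit_map H N ∘ (sub_val f ∘ ind_in M alg_one)
  = hm_coact N ∘ (sub_val f ∘ ind_in M alg_one).
Proof.
have [_ hf] := sub_valP f.
(* Colinearity moves the coaction inside [f], where it meets [coact A 1 = 1 ⊗ 1]. *)
rewrite unit_mapE (mcompA (hm_coact N)) hf -mcompA [X in _ = _ ∘ X]ind_coact_el.
by rewrite (coact_morph A).1 ind_tinE !mcompA tmapE.
Qed.
Definition ind_transpose_map (f : mor (ind_functor S A M) N) :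
    mor (lm_obj M) (coinv_obj N) :=
  eqz_lift (ind_transpose_subproof f).
Lemma ind_transpose_mapE f :
  coinv_map N ∘ ind_transpose_map f = sub_val f ∘ ind_in M alg_one.
Proof. exact: eqz_liftE. Qed.

Lemma ind_transpose_lmod f :
  is_lmod_hom (lm_act M) (coinv_act N) (ind_transpose_map f).
Proof.
apply/is_lmod_homP => b; apply: coinv_mono.
(* Balancing over [B] gives [1 ⊗ b m = b ⊗ m]; it remains to pull [b] out of [f]. *)
rewrite mcompA ind_transpose_mapE -mcompA -ind_in_balanced alg_mul1l.
rewrite mcompA coinv_act_el -mcompA ind_transpose_mapE.
exact: hom_ind_in.
Qed.
Definition ind_transpose (f : mor (ind_functor S A M) N) :
    mor M (coinv_functor S A N) :=
  sub_mk _ (ind_transpose_lmod f).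

Lemma ind_transposeE f :
  coinv_map N ∘ sub_val (ind_transpose f) = sub_val f ∘ ind_in M alg_one.
Proof. exact: ind_transpose_mapE. Qed.

Lemma ind_transpose_linear : linear ind_transpose.
Proof.
move=> c f g; apply: sub_val_inj; apply: coinv_mono.
by rewrite ind_transposeE /= comp_linr !ind_transpose_mapE comp_linl.
Qed.
End ToCoinvariants.

Section FromCoinvariants.
Variables (M : lmod_cat S (coinv A)) (N : hopf_cat S A).

(** The map [a ⊗ m |-> a g(m)] is balanced over [B], hence descends to [A ⊗_B M]: associativity and
    the [B]-linearity of [g] give [(a b) g(m) = a (b g(m)) = a g(b m)]. *)
Lemma coinv_transpose_subproof (g : mor M (coinv_functor S A N)) :
  hm_act N ∘ tmap (coinv_map N ∘ sub_val g) (lid A) ∘ tmap (lm_act M) (lid A)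
  = hm_act N ∘ tmap (coinv_map N ∘ sub_val g) (lid A)
    ∘ (tmap (idm (lm_obj M)) (@right_mul k H A) ∘ lassoc M A (coinv A)).
Proof.
have /is_lmod_homP hg := sub_valP g.
have /is_lmoduleP[hN _] := hm_lmodule N.
apply: ind_desc_subproof => a b.
rewrite -!(mcompA (hm_act N)) !tmapE !LinE /= (mcompA (hm_act N)) -hN -!mcompA hg.
by rewrite (mcompA (coinv_map N)) coinv_act_el !mcompA.
Qed.
Definition coinv_transpose_map (g : mor M (coinv_functor S A N)) :
    mor (ind_obj M) (hm_obj N) :=
  coeq_desc (coinv_transpose_subproof g).
Lemma coinv_transpose_mapE g a : coinv_transpose_map g ∘ ind_in M a
  = hm_act N ∘ tin a ∘ (coinv_map N ∘ sub_val g).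
Proof. by rewrite [LHS]mcompA coeq_descE -[LHS]mcompA tmapE LinE mcompA. Qed.

(** [A]-linearity is associativity of the action on [N]. For colinearity, Hopf compatibility sends
    [a g(m)] to [coact A a] acting on [g(m) ⊗ 1], because [g(m)] is coinvariant; this is
    [a_0 g(m) ⊗ a_1]. *)
Lemma coinv_transpose_hopf g :
  @is_hopf_hom k S H A (ind_hopf_module M) N (coinv_transpose_map g).
Proof.
have /is_lmoduleP[hN _] := hm_lmodule N.
have /hopf_compatibleP hc := hm_compatible N.
split.
  apply/is_lmod_homP => a; apply: ind_ext => x /=.
  rewrite ind_act_el -!mcompA ind_lmulE !coinv_transpose_mapE -hN.
  by rewrite !mcompA.
apply: ind_ext => a /=.
rewrite -!mcompA coinv_transpose_mapE ind_coact_el.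
rewrite (mcompA (hm_coact N)) hc -mcompA (mcompA (hm_coact N)) -coinv_mapE.
(* Both sides are linear in [coact A a], so it may be replaced by a pure tensor [u ⊗ h]. *)
move: (coact A a); apply: vtens_lin_ext.
- by apply: compl_linear; apply: diag_act_linear.
- by apply: compr_linear; apply: ind_tin_linear.
move=> u h; rewrite -(mcompA (tin _)) mcompA diag_actE alg_mul1r ind_tinE.
by rewrite [RHS]mcompA tmapE LinE -[RHS]mcompA coinv_transpose_mapE !mcompA.
Qed.
Definition coinv_transpose (g : mor M (coinv_functor S A N)) :
    mor (ind_functor S A M) N :=
  sub_mk _ (coinv_transpose_hopf g).

Lemma ind_transposeK : cancel (@ind_transpose M N) coinv_transpose.
Proof.
move=> f; apply: sub_val_inj; apply: ind_ext => a.
by rewrite [LHS]coinv_transpose_mapE ind_transposeE -hom_ind_in.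
Qed.
Lemma coinv_transposeK : cancel coinv_transpose (@ind_transpose M N).
Proof.
have /is_lmoduleP[_ hN] := hm_lmodule N.
move=> g; apply: sub_val_inj; apply: coinv_mono.
(* Evaluating at [1 ⊗ m] leaves [1 g(m)], so the unit axiom of [N] concludes. *)
by rewrite ind_transposeE [LHS]coinv_transpose_mapE hN comp1m.
Qed.
End FromCoinvariants.

(** Followed by the monomorphism [coinv_map N'], both sides become [n ∘ f ∘ ind_in M 1 ∘ m]. *)
Lemma ind_transpose_natural M M' N N' (m : mor M' M) (n : mor N N')
    (f : mor (ind_functor S A M) N) :
  ind_transpose (n ∘ f ∘ fmap (ind_functor S A) m)
  = fmap (coinv_functor S A) n ∘ ind_transpose f ∘ m.
Proof.
apply: sub_val_inj; apply: coinv_mono; rewrite ind_transposeE /=.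
rewrite -mcompA ind_hom_mapE !mcompA coinv_hom_mapE.
by rewrite -(mcompA _ (coinv_map N)) ind_transpose_mapE !mcompA.
Qed.
End Adjunction.

Theorem proposition6p12 (k : fieldType) (S : grothendieck_category k)
    (H : hopf_algebra k) (hH : cosemisimple H) (A : comodule_algebra H) :
  exists Phi : forall (M : lmod_cat S (coinv A)) (N : hopf_cat S A),
      {linear mor (ind_functor S A M) N -> mor M (coinv_functor S A N)},
    (forall M N, bijective (Phi M N)) /\
    (forall (M M' : lmod_cat S (coinv A)) (N N' : hopf_cat S A)
        (m : mor M' M) (n : mor N N') (f : mor (ind_functor S A M) N),
      Phi M' N' (n ∘ f ∘ fmap (ind_functor S A) m)
        = fmap (coinv_functor S A) n ∘ Phi M N f ∘ m).
Proof.
exists (fun M N => Lin (@ind_transpose_linear k S H A M N)); split.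
  move=> M N; exists (@coinv_transpose k S H A M N).
    exact: ind_transposeK.
  exact: coinv_transposeK.
exact: ind_transpose_natural.
Qed.
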